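(* Let $\mathcal D$ be a data cube and let $\phi$ be a Boolean condition on the cells of $M(\mathcal D)$ that is a Boolean combination of conditions of the following forms: (a) a selector on a value $b$ at a level $\ell$ of some dimension $D_i$ (satisfied by the cell $(x_1,\dots,x_d)$ iff $x_i$ rolls up to $b$); (b) a comparison $\ell<c$ or $c<\ell$ at a level $\ell$ of the schema $\sigma(D_i)$ of some dimension $D_i$, where $c$ is a constant in $dom(D_i.\ell)$; (c) $\alpha=c$, $\alpha<c$ or $c<\alpha$, where $\alpha$ is a measure of $\mathcal D$ and $c$ is a rational constant. Then the operation $\mathsf{DICE}(\mathcal D,\phi)$ is expressible as an OLAP operation.
   Context: **Dimensions.** A dimension $D$ has a schema $\sigma(D)$: a finite lattice, viewed as a directed graph of levels, with a unique top node $All$ (only incoming edges) and a unique bottom node $Bottom$ (only outgoing edges), all maximal-length paths going from $Bottom$ to $All$. A path from $Bottom$ to $All$ is a hierarchy of $\sigma(D)$. Each level $\ell$ has a non-empty finite set $dom(D.\ell)$, with $dom(D.All)=\{all\}$ and $dom(D.Bottom)=dom(D)$, and $dom(D)$ is totally ordered by $<$. A dimension graph $I(\sigma(D))$ is a directed acyclic graph with node set $\bigcup_\ell dom(D.\ell)$, in which an edge from $a\in dom(D.\ell)$ to $a'\in dom(D.\ell')$ can exist only if $\ell\to\ell'$ is an edge of $\sigma(D)$. For each hierarchy $H$, the subgraph $I_H(\sigma(D))$ on the nodes belonging to the levels of $H$ is a directed tree, directed towards its root $all$. Write $\rho_H(a,b)$ (''$a$ rolls up to $b$'') if $b$ is reachable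 from $a$ in $I_H(\sigma(D))$ (with $a$ rolling up to itself), and $\rho$ if $H$ is clear from the context. Dimension graphs are sound: for every level $\ell$, hierarchies $H_1,H_2$ reaching $\ell$ from $Bottom$, $a\in dom(D)$ and $b_1,b_2\in dom(D.\ell)$, $\rho_{H_1}(a,b_1)$ and $\rho_{H_2}(a,b_2)$ imply $b_1=b_2$. Every $b\in dom(D.\ell)$ has at least one $a\in dom(D)$ with $\rho(a,b)$; $rep(b)$ denotes the smallest such $a$. Put $b_1<b_2$ in $dom(D.\ell)$ iff $rep(b_1)<rep(b_2)$. **Data cubes.** A $d$-dimensional data cube $\mathcal D$ ($d\ge1$) consists of: the matrix $M(\mathcal D)=dom(D_1)\times\cdots\times dom(D_d)$, whose elements are called cells; sound dimension graphs $I(\sigma(D_i))$; protected measures $\mu_1,\dots,\mu_k$ and computed measures $\tau_1,\dots,\tau_l$ ($l\ge0$), which are functions from the cells to $\mathbb Q$; and a flag $\varphi$ from the cells to $\{0,1\}$. Some cells may be empty (destroyed): they carry no measures and no flag, they are ignored in all computations, and no measure is ever added to them. **Prime labels.** These are the numbers $1,\sqrt2,\sqrt3,\sqrt5,\sqrt7,\dots,\sqrt{p_n},\dots$ ($p_n$ the $n$-th prime), used symbolically; intermediate computed measures may have values involving them. A prime product label is a product of prime labels coming from labelings of different dimensions that use disjoint sets of labels. If the label of a cell is the product of labels for the dimensions with index in $I\subseteq\{1,\dots,d\}$, then for a rational-valued measure $\mu$ the sum over all non-empty cells of $\mu$ times the label is called a (full or partial) prime sum; it can be written $\sum_w a_w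 w$, with $w$ ranging over the labels that occur. **Atomic OLAP transformations.** Each creates, in all non-empty cells $(x_1,\dots,x_d)$, a new measure $\tau_{new}$ from the existing measures; $\alpha,\beta$ denote existing (protected or computed) measures. - Arithmetic: $\tau_{new}=c$ with $c\in\mathbb Q$; $\tau_{new}=\alpha+\beta$; $\tau_{new}=\alpha\cdot\beta$; $\tau_{new}=\alpha/\beta$, with the convention $a/0:=a$. - Boolean (values $0/1$, cell per cell): $(\alpha=\beta)$; $(\alpha<\beta)$; $(\ell=c)$ for a level $\ell$ of $\sigma(D_i)$ and $c\in dom(D_i.\ell)$, equal to $1$ iff $\rho(x_i,c)$; $(\ell<_\ell c)$, equal to $1$ iff $x_i$ rolls up to some $b\in dom(D_i.\ell)$ with $b<_\ell c$, where $<_\ell$ is any order defined on level $\ell$; similarly $(c<_\ell \ell)$. - Selectors: the constant selector $\sigma_{D_i.\ell=c}$, which equals the test $(\ell=c)$; the level selector $\sigma_{D_i.\ell}$, equal to $1$ iff $x_i=rep(b)$ for some $b\in dom(D_i.\ell)$, and $0$ otherwise. - Global aggregates (the same value in all non-empty cells): $\#_{\neq}(\alpha)$, the number of distinct values of $\alpha$ in the matrix; $\mathrm{SUM}_d(\alpha)$, the sum of $\alpha$ over all non-empty cells; $\min(\alpha)$; $\max(\alpha)$. - Grouped aggregates: if $\tau_m$ is a prime (product) labeling of the cells, then $\#_{\neq}|_{\tau_m}(\alpha)$, $\min|_{\tau_m}(\alpha)$ and $\max|_{\tau_m}(\alpha)$ are, in each cell $x$, the number of distinct values, minimum and maximum of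 $\alpha$ over the cells having the same label as $\tau_m(x)$. - Grouping: $\gamma_{D_i.\ell}$, where $dom(D_i.\ell)=\{b_1<\dots<b_s\}$: the next $s$ prime labels not yet used by earlier transformations are assigned in order to $b_1,\dots,b_s$, and a cell with $\rho(x_i,b_j)$ receives the label of $b_j$. Projection of a prime sum $\tau_m|_{\tau_n}$: if $\tau_m$ is a prime sum $\sum_w a_w w$ over the labels of an earlier prime (product) labeling $\tau_n$, the new measure has value $a_w$ in each cell where $\tau_n=w$. **OLAP operation (of arity $m$).** It is a finite sequence of $n$ atomic transformations creating $\tau_{l+1},\dots,\tau_{l+n}$, followed by the creation of a Boolean measure $\varphi^{(m)}$ (the output flag), optionally preceded by the creation of a Boolean measure $\delta$ (a destructor); $\delta$ and $\varphi^{(m)}$ are created by atomic transformations or set equal to existing Boolean measures. In the output cube, dimensions, schemas and dimension graphs are unchanged; cells with $\delta=0$ are emptied (even of their protected measures); in the other non-empty cells the measures are $\mu_1,\dots,\mu_k$, the last $m$ computed measures $\tau_{l+n-m+1},\dots,\tau_{l+n}$ (renamed $\tau_1,\dots,\tau_m$), and the new flag $\varphi^{(m)}$ replacing the old one. An operation on data cubes is expressible as an OLAP operation if there is an OLAP operation (its sequence of transformations being chosen from the parameters of the operation, the numbers of measures, and the dimension schemas and graphs) whose output on the input cube is the output of the operation. **Dice.** $\mathsf{DICE}(\mathcal D,\phi)$ selects all (non-empty) cells of $M(\mathcal D)$ satisfying $\phi$: these get flag $1$ in the output and keep their measures; all other cells are destroyed. *)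

(* Defs.v *)
From HB Require Import structures.
From mathcomp Require Import all_boot all_order all_algebra.
From mathcomp Require Import realalg.
From mathcomp Require Import boolp.

Set Implicit Arguments.
Unset Strict Implicit.
Unset Printing Implicit Defensive.

Import Order.TTheory GRing.Theory Num.Theory.

Local Open Scope ring_scope.

(* A finite lattice presented by a directed graph: the order is reachability
   along the edges.  Acyclicity, the facts that All = \top only has incoming
   and Bottom = \bot only has outgoing edges, and that every maximal path runs
   from Bottom to All all follow from these fields.  The edges need not be the
   covering pairs of the order. *)
Record schema := Schema {
  schema_disp : Order.disp_t;
  level :> finTBLatticeType schema_disp;
  edge : rel level;
  edge_irr : irreflexive edge;
  connect_edge : forall l l' : level, connect edge l l' = (l <= l')%O }.

Definition hierarchy (S : schema) (H : seq S) : bool :=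
  if H is l :: p then [&& l == \bot%O, path (@edge S) l p & last l p == \top%O]
  else false.

(* Members of distinct levels are distinct nodes. *)
Definition node (S : schema) (dom : S -> finType) : finType := {l : S & dom l}.

Definition within (S : schema) (dom : S -> finType) (g : rel (node dom))
    (H : seq S) : rel (node dom) :=
  [rel a b | [&& tag a \in H, tag b \in H & g a b]].

(* A directed graph is a tree directed towards its root iff each node has
   exactly one walk to the root. *)
Definition in_tree (S : schema) (dom : S -> finType) (g : rel (node dom))
    (H : seq S) (root : node dom) : Prop :=
  forall a, tag a \in H ->
    exists! p, path (within g H) a p /\ last a p = root.

Definition rollup_in (S : schema) (dom : S -> finType) (g : rel (node dom))
    (H : seq S) (a b : node dom) : bool :=
  [&& tag a \in H, tag b \in H & connect (within g H) a b].

Definition strict_order (T : Type) := {r : rel T | irreflexive r /\ transitive r}.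

Record dimension := Dimension {
  dim_schema :> schema;
  dom : dim_schema -> finType;
  dom_inh : forall l, (0 < #|dom l|)%N;
  dom_all : dom \top%O;
  dom_top : forall b : dom \top%O, b = dom_all;
  base_le : rel (dom \bot%O);
  base_le_order : [/\ reflexive base_le, antisymmetric base_le,
                      transitive base_le & total base_le];
  graph : rel (node dom);
  graph_edge : forall a b, graph a b -> edge (tag a) (tag b);
  graph_tree : forall H, hierarchy H ->
    in_tree graph H (Tagged dom dom_all);
  graph_sound : forall (l : dim_schema) H1 H2 (a : dom \bot%O) (b1 b2 : dom l),
    hierarchy H1 -> hierarchy H2 ->
    rollup_in graph H1 (Tagged dom a) (Tagged dom b1) ->
    rollup_in graph H2 (Tagged dom a) (Tagged dom b2) -> b1 = b2;
  graph_cover : forall (l : dim_schema) (b : dom l), exists H (a : dom \bot%O),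
    hierarchy H /\ rollup_in graph H (Tagged dom a) (Tagged dom b) }.

Arguments dom_all {_}.
Arguments base_le {_}.
Arguments graph {_}.

Section Levels.
Context {D : dimension}.

(* By soundness the hierarchy does not affect which member of a level a base
   member rolls up to. *)
Definition rollup (a : dom (\bot%O : D)) (l : D) (b : dom l) : bool :=
  `[< exists2 H, hierarchy H &
        rollup_in graph H (Tagged (@dom D) a) (Tagged (@dom D) b) >].

Lemma rollup_ex (l : D) (b : dom l) : exists a, rollup a b.
Proof.
by have [H [a [hH ab]]] := graph_cover b; exists a; apply/asboolP; exists H.
Qed.

Definition rep (l : D) (b : dom l) : dom (\bot%O : D) :=
  extremum base_le (xchoose (rollup_ex b)) (fun a => rollup a b) id.

Definition base_lt (a a' : dom (\bot%O : D)) : bool := (a != a') && base_le a a'.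

Definition level_lt (l : D) : rel (dom l) :=
  [rel b1 b2 | base_lt (rep b1) (rep b2)].

Lemma level_lt_order (l : D) :
  irreflexive (@level_lt l) /\ transitive (@level_lt l).
Proof.
have [_ asym tr _] := base_le_order D.
split=> [b|b2 b1 b3 /=]; first by rewrite /level_lt /= /base_lt eqxx.
move=> /andP[n12 le12] /andP[n23 le23].
rewrite /level_lt /= /base_lt (tr _ _ _ le12 le23) andbT.
apply: contraNneq n12 => e13; apply/eqP/asym.
by rewrite le12 /= e13.
Qed.

Definition level_order (l : D) : strict_order (dom l) :=
  exist _ (@level_lt l) (level_lt_order l).

End Levels.

Definition cell (d : nat) (D : 'I_d -> dimension) : finType :=
  {dffun forall i : 'I_d, dom (\bot%O : D i)}.

Record content (k l : nat) := Content {
  protected : {ffun 'I_k -> rat};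
  computed : {ffun 'I_l -> rat};
  flag : bool }.

(* The cubes over fixed dimensions, k protected and l computed measures;
   None marks an empty cell. *)
Definition cube (d : nat) (D : 'I_d -> dimension) (k l : nat) :=
  {ffun cell D -> option (content k l)}.

Definition full_cell (d : nat) (D : 'I_d -> dimension) (k l : nat)
    (C : cube D k l) : finType := {x : cell D | C x : bool}.

Lemma full_content (d : nat) (D : 'I_d -> dimension) (k l : nat)
  (C : cube D k l) (x : full_cell C) : {c | C (val x) = Some c}.
Proof. by case: x => x /=; case: (C x) => // c _; exists c. Qed.

Definition content_at (d : nat) (D : 'I_d -> dimension) (k l : nat)
    (C : cube D k l) (x : full_cell C) : content k l := sval (full_content x).

(* All values occurring during an operation are real algebraic numbers.  The
   symbolic reading of prime labels agrees with the numerical one because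
   square roots of distinct squarefree integers are linearly independent over
   the rationals. *)

Lemma next_prime_ex (n : nat) : exists p, (n < p)%N && prime p.
Proof. by have [p np pp] := prime_above n; exists p; rewrite np. Qed.

Definition next_prime (n : nat) : nat := ex_minn (next_prime_ex n).

(* The labels 1, sqrt 2, sqrt 3, sqrt 5, ..., numbered from 0. *)
Definition prime_label (n : nat) : realalg :=
  if n is n'.+1 then Num.sqrt (iter n' next_prime 2%N)%:R else 1.

(* A reference to an existing measure; computed measures are numbered from 0,
   those of the input cube coming first. *)
Inductive measure_ref (k : nat) :=
| Protected of 'I_k
| Computed of nat.

Section Transformations.
Context (d : nat) (D : 'I_d -> dimension) (k : nat).

Inductive transformation : Type :=
| TConst of rat
| TAdd of measure_ref k & measure_ref k
| TMul of measure_ref k & measure_ref k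
| TDiv of measure_ref k & measure_ref k
| TEq of measure_ref k & measure_ref k
| TLt of measure_ref k & measure_ref k
| TLevelEq (i : 'I_d) (l : D i) of dom l
| TLevelLt (i : 'I_d) (l : D i) of strict_order (dom l) & dom l
| TLevelGt (i : 'I_d) (l : D i) of strict_order (dom l) & dom l
| TSelConst (i : 'I_d) (l : D i) of dom l
| TSelLevel (i : 'I_d) (l : D i)
| TCountDistinct of measure_ref k
| TSum of measure_ref k
| TMin of measure_ref k
| TMax of measure_ref k
(* in grouped aggregates the labeling comes first *)
| TGroupedCountDistinct of measure_ref k & measure_ref k
| TGroupedMin of measure_ref k & measure_ref k
| TGroupedMax of measure_ref k & measure_ref k
| TGroup (i : 'I_d) (l : D i)
(* the first measure is projected along the second *)
| TProject of measure_ref k & measure_ref k.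

End Transformations.

(* The label received by the base member a when grouping on level l after u
   labels have been used; a rolls up to exactly one member of l. *)
Definition group_label (D : dimension) (l : D) (u : nat)
    (a : dom (\bot%O : D)) : realalg :=
  if [pick b : dom l | rollup a b] is Some b
  then prime_label (u + #|[pred b' | level_lt b' b]|)%N
  else 0.

Section Semantics.
Context (d : nat) (D : 'I_d -> dimension) (k l : nat) (C : cube D k l).

(* Measures only have values in the non-empty cells. *)
Definition measure := {ffun full_cell C -> realalg}.

Record state := State {
  st_computed : seq measure;
  (* (j, i) records that the j-th computed measure is a prime labeling
     created by grouping on dimension i *)
  st_labelings : seq (nat * 'I_d);
  st_used_labels : nat }.

Definition init : state :=
  State [seq [ffun x => ratr (computed (content_at x) j)] | j <- enum 'I_l]
        [::] 0%N.

Definition lookup (st : state) (r : measure_ref k) : option measure :=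
  match r with
  | Protected j => Some [ffun x => ratr (protected (content_at x) j)]
  | Computed j => if (j < size (st_computed st))%N
                  then Some (nth 0 (st_computed st) j) else None
  end.

Definition is_labeling (st : state) (m : measure) : bool :=
  `[< exists (I : {set 'I_d}) (g : 'I_d -> nat),
        {in I, forall i, (g i, i) \in st_labelings st} /\
        forall x, m x = \prod_(i in I) nth 0 (st_computed st) (g i) x >].

Definition bool_measure (P : pred (cell D)) : measure :=
  [ffun x => (P (val x))%:R].

Definition label_values (n : measure) : seq realalg := undup (codom n).

Definition prime_sum (m n : measure) (a : realalg -> rat) : Prop :=
  forall x, m x = \sum_(w <- label_values n) ratr (a w) * w.

(* The coefficients are unique on the labels of a prime (product) labeling. *)
Definition project (m n : measure) : option measure :=
  match pselect (exists a, prime_sum m n a) with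
  | left ex => Some [ffun x => ratr (sval (cid ex) (n x))]
  | right _ => None
  end.

Definition lift1 (f : measure -> option measure) (st : state)
    (r : measure_ref k) : option measure :=
  obind f (lookup st r).

Definition lift2 (f : measure -> measure -> option measure) (st : state)
    (r s : measure_ref k) : option measure :=
  lift1 (fun a => lift1 (f a) st s) st r.

Definition count_distinct (n a : measure) : measure :=
  [ffun x => (size (undup [seq a y | y in [pred y | n y == n x]]))%:R].

Definition min_over (n a : measure) : measure :=
  [ffun x => \big[Num.min/a x]_(y | n y == n x) a y].

Definition max_over (n a : measure) : measure :=
  [ffun x => \big[Num.max/a x]_(y | n y == n x) a y].

Definition grouped (f : measure -> measure -> measure) (st : state)
    (r s : measure_ref k) : option measure :=
  lift2 (fun n a => if is_labeling st n then Some (f n a) else None) st r s.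

(* The new measure, or None if the transformation is not applicable: a
   reference to a measure that does not exist, or a grouped aggregate or
   projection along something that is not a prime (product) labeling. Global
   aggregates are grouped along the constant 0. *)
Definition eval (st : state) (t : transformation D k) : option measure :=
  match t with
  | TConst c => Some [ffun => ratr c]
  | TAdd r s => lift2 (fun a b => Some [ffun x => a x + b x]) st r s
  | TMul r s => lift2 (fun a b => Some [ffun x => a x * b x]) st r s
  | TDiv r s => lift2 (fun a b =>
      Some [ffun x => if b x == 0 then a x else a x / b x]) st r s
  | TEq r s => lift2 (fun a b => Some [ffun x => (a x == b x)%:R]) st r s
  | TLt r s => lift2 (fun a b => Some [ffun x => (a x < b x)%R%:R]) st r s
  | TLevelEq i l c => Some (bool_measure (fun x => rollup (x i) c))
  | TLevelLt i l o c => Some (bool_measure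
      (fun x => [exists b, rollup (x i) b && sval o b c]))
  | TLevelGt i l o c => Some (bool_measure
      (fun x => [exists b, rollup (x i) b && sval o c b]))
  | TSelConst i l c => Some (bool_measure (fun x => rollup (x i) c))
  | TSelLevel i l => Some (bool_measure
      (fun x => [exists b : dom l, x i == rep b]))
  | TCountDistinct r => lift1 (fun a => Some (count_distinct 0 a)) st r
  | TSum r => lift1 (fun a => Some [ffun => \sum_y a y]) st r
  | TMin r => lift1 (fun a => Some (min_over 0 a)) st r
  | TMax r => lift1 (fun a => Some (max_over 0 a)) st r
  | TGroupedCountDistinct r s => grouped count_distinct st r s
  | TGroupedMin r s => grouped min_over st r s
  | TGroupedMax r s => grouped max_over st r s
  | TGroup i l => Some
      [ffun x : full_cell C => group_label l (st_used_labels st) (val x i)]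
  | TProject r s => lift2 (fun m n =>
      if is_labeling st n then project m n else None) st r s
  end.

Definition register (st : state) (t : transformation D k) (m : measure) : state :=
  let ms := rcons (st_computed st) m in
  if t is TGroup i l
  then State ms ((size (st_computed st), i) :: st_labelings st)
             (st_used_labels st + #|dom l|)%N
  else State ms (st_labelings st) (st_used_labels st).

Fixpoint run (st : state) (ts : seq (transformation D k)) : option state :=
  if ts is t :: ts' then obind (fun m => run (register st t m) ts') (eval st t)
  else Some st.

End Semantics.

Inductive creation (d : nat) (D : 'I_d -> dimension) (k : nat) :=
| New of transformation D k
| Existing of measure_ref k.

Record operation (d : nat) (D : 'I_d -> dimension) (k : nat) := Operation {
  op_steps : seq (transformation D k);
  op_destructor : option (creation D k);
  op_flag : creation D k }.

Section Output.
Context (d : nat) (D : 'I_d -> dimension) (k l m : nat) (C : cube D k l).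

(* The created measure, required to be Boolean, and the state extended by it. *)
Definition create (st : state C) (c : creation D k) :
    option (measure C * state C) :=
  let boolean (v : measure C) := [forall x, (v x == 0) || (v x == 1)] in
  match c with
  | New t => if eval st t is Some v then
      if boolean v then Some (v, register st t v) else None else None
  | Existing r => if lookup st r is Some v then
      if boolean v then Some (v, State (rcons (st_computed st) v)
        (st_labelings st) (st_used_labels st)) else None else None
  end.

Definition create_destructor (st : state C) (c : option (creation D k)) :
    option (measure C * state C) :=
  if c is Some c' then create st c' else Some ([ffun => 1], st).

Definition op_output (o : operation D k) (C' : cube D k m) : Prop :=
  exists st delta st' phi st'',
  [/\ run (init C) (op_steps o) = Some st,
      create_destructor st (op_destructor o) = Some (delta, st'),
      create st' (op_flag o) = Some (phi, st''),
      (m <= size (st_computed st))%N &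
      (forall x, C x = None -> C' x = None) /\
      (forall x : full_cell C,
         if delta x == 0 then C' (val x) = None else
         exists2 c, C' (val x) = Some c &
         [/\ protected c = protected (content_at x),
             forall j : 'I_m, ratr (computed c j) =
               nth 0 (st_computed st) (size (st_computed st) - m + j)%N x
           & flag c = (phi x == 1)])].

End Output.

(* The operation may depend on the dimensions, on the numbers of measures and
   on the parameters of F, but not on the contents of the cube. *)
Definition expressible (d : nat) (D : 'I_d -> dimension) (k l m : nat)
    (F : cube D k l -> cube D k m) : Prop :=
  exists o : operation D k, forall (C : cube D k l) (C' : cube D k m),
    op_output C o C' <-> C' = F C.

Section Dice.
Context (d : nat) (D : 'I_d -> dimension) (k l : nat).

(* A level may be compared with respect to any strict order on it, such as
   the order level_order induced by the representatives. *)
Inductive condition : Type :=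
| Selects (i : 'I_d) (l : D i) of dom l
| LevelBelow (i : 'I_d) (l : D i) of strict_order (dom l) & dom l
| LevelAbove (i : 'I_d) (l : D i) of strict_order (dom l) & dom l
| MeasureEq of 'I_k + 'I_l & rat
| MeasureBelow of 'I_k + 'I_l & rat
| MeasureAbove of 'I_k + 'I_l & rat
| Not of condition
| And of condition & condition
| Or of condition & condition.

Definition measure_value (c : content k l) (a : 'I_k + 'I_l) : rat :=
  match a with inl j => protected c j | inr j => computed c j end.

Fixpoint satisfies (x : cell D) (c : content k l) (phi : condition) : bool :=
  match phi with
  | Selects i _ b => rollup (x i) b
  | LevelBelow i _ o b => [exists b', rollup (x i) b' && sval o b' b]
  | LevelAbove i _ o b => [exists b', rollup (x i) b' && sval o b b']
  | MeasureEq a q => measure_value c a == q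
  | MeasureBelow a q => measure_value c a < q
  | MeasureAbove a q => q < measure_value c a
  | Not p => ~~ satisfies x c p
  | And p q => satisfies x c p && satisfies x c q
  | Or p q => satisfies x c p || satisfies x c q
  end.

Definition dice (phi : condition) (C : cube D k l) : cube D k l :=
  [ffun x => if C x is Some c then
     if satisfies x c phi then Some (Content (protected c) (computed c) true)
     else None else None].

End Dice.

(* Main.v *)
(** A Boolean combination of conditions is evaluated cell by cell with 0/1
    arithmetic on measures: conjunction is a product, negation is the test
    [v = 0], disjunction is the test [0 < v + w].  The resulting 0/1 measure
    serves both as destructor and as flag.  Since an operation keeps only the
    most recent measures, the computed measures of the input cube are finally
    recreated by adding 0 to each of them. *)

Require Import Defs.
From mathcomp Require Import all_boot all_order all_algebra.
From mathcomp Require Import realalg boolp.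

Set Implicit Arguments.
Unset Strict Implicit.
Unset Printing Implicit Defensive.

Import Order.TTheory GRing.Theory Num.Theory.

Local Open Scope ring_scope.

(** * Composition of sequences of transformations *)

Section Run.
Context (d : nat) (D : 'I_d -> dimension) (k l : nat) (C : cube D k l).

Lemma run_cat (st : state C) (ts us : seq (transformation D k)) :
  run st (ts ++ us) = obind (fun st' => run st' us) (run st ts).
Proof.
elim: ts st => [|t ts IH] st //=.
by case: (eval st t) => //= m; rewrite IH.
Qed.

(** Lookup depends only on the computed measures; quantifying over [lab] and [u] makes a reference
    usable in every state with the list [s]. *)
Definition refers (s : seq (measure C)) (r : measure_ref k) (v : measure C) :=
  forall lab u, lookup (State s lab u) r = Some v.

Lemma refers_computed s j : (j < size s)%N ->
  refers s (Computed k j) (nth 0 s j).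
Proof. by move=> js lab u /=; rewrite js. Qed.

Lemma refers_last s t v :
  refers (s ++ rcons t v) (Computed k (size s + size t)) v.
Proof.
have := @refers_computed (s ++ rcons t v) (size s + size t).
rewrite -{3}rcons_cat -size_cat nth_rcons ltnn eqxx; apply.
by rewrite !size_cat size_rcons addnS.
Qed.

(** New measures are only appended, so the numbering of older ones never shifts. *)
Lemma refers_cat s t r v : refers s r v -> refers (s ++ t) r v.
Proof.
case: r => [i|j] h lab u; have := h lab u; rewrite /= ?size_cat //.
by case: ltnP => // js [<-]; rewrite ltn_addr // nth_cat js.
Qed.

(** The intermediate measures [t] stay anonymous: later steps need only their number, to compute
    positions. Since [lab] and [u] come back unchanged, no grouping is involved. *)
Definition creates s (ts : seq (transformation D k)) (v : measure C) : Prop :=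
  exists2 t, size ts = (size t).+1 &
    forall lab u, run (State s lab u) ts = Some (State (s ++ rcons t v) lab u).

Definition not_grouping (t : transformation D k) : bool :=
  if t is TGroup _ _ then false else true.

Lemma creates1 s t v : not_grouping t ->
  (forall lab u, eval (State s lab u) t = Some v) -> creates s [:: t] v.
Proof.
move=> nt ev; exists [::] => // lab u.
by rewrite /= ev /= cats1; case: t {ev} nt.
Qed.

(** The second sequence starts after measures of which only the number and the last one are known,
    so it has to work for every [t] of that length. *)
Lemma creates_cat s ts us v w : creates s ts v ->
  (forall t, size ts = (size t).+1 -> creates (s ++ rcons t v) us w) ->
  creates s (ts ++ us) w.
Proof.
case=> t szt rt /(_ t szt) [t' szt' rt'].
exists (rcons t v ++ t').
  by rewrite !size_cat size_rcons szt szt' addnS.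
by move=> lab u; rewrite run_cat rt /= rt' rcons_cat catA.
Qed.

Lemma lift2_refers s r1 r2 a b lab u f : refers s r1 a -> refers s r2 b ->
  lift2 f (State s lab u) r1 r2 = f a b.
Proof. by move=> h1 h2; rewrite /lift2 /lift1 h1 /= h2. Qed.

Lemma creates_const s q : creates s [:: TConst D k q] [ffun=> ratr q].
Proof. exact: creates1. Qed.

End Run.

(** * Evaluating conditions by 0/1 arithmetic, and copying the input measures *)

Section Condition.
Context (d : nat) (D : 'I_d -> dimension) (k l : nat).

Definition ref_of (a : 'I_k + 'I_l) : measure_ref k :=
  match a with inl j => Protected j | inr j => Computed k j end.

(* [n] is the number of computed measures that exist beforehand; the truth
   value is the last measure created. *)
Fixpoint condition_steps (n : nat) (phi : condition D k l) :
    seq (transformation D k) :=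
  match phi with
  | Selects i _ b => [:: TSelConst k b]
  | LevelBelow i _ o b => [:: TLevelLt k o b]
  | LevelAbove i _ o b => [:: TLevelGt k o b]
  | MeasureEq a q =>
      [:: TConst D k q] ++ [:: TEq D (ref_of a) (Computed k n)]
  | MeasureBelow a q =>
      [:: TConst D k q] ++ [:: TLt D (ref_of a) (Computed k n)]
  | MeasureAbove a q =>
      [:: TConst D k q] ++ [:: TLt D (Computed k n) (ref_of a)]
  | Not p =>
      let ts := condition_steps n p in
      let n1 := (n + size ts)%N in
      ts ++ [:: TConst D k 0] ++ [:: TEq D (Computed k n1.-1) (Computed k n1)]
  | And p q =>
      let ts := condition_steps n p in
      let n1 := (n + size ts)%N in
      let us := condition_steps n1 q in
      let n2 := (n1 + size us)%N in
      ts ++ us ++ [:: TMul D (Computed k n1.-1) (Computed k n2.-1)]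
  | Or p q =>
      let ts := condition_steps n p in
      let n1 := (n + size ts)%N in
      let us := condition_steps n1 q in
      let n2 := (n1 + size us)%N in
      ts ++ us ++ [:: TAdd D (Computed k n1.-1) (Computed k n2.-1)] ++
        [:: TConst D k 0] ++ [:: TLt D (Computed k n2.+1) (Computed k n2)]
  end.

Context (C : cube D k l).

Definition input_measure (a : 'I_k + 'I_l) : measure C :=
  [ffun x => ratr (measure_value (content_at x) a)].

Definition truth (phi : condition D k l) : measure C :=
  [ffun x => (satisfies (val x) (content_at x) phi)%:R].

(** The invariant that lets atomic conditions read the input measures at any stage of the
    evaluation. *)
Definition keeps_input (s : seq (measure C)) : Prop :=
  forall a, refers s (ref_of a) (input_measure a).

Lemma keeps_input_cat s t : keeps_input s -> keeps_input (s ++ t).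
Proof. by move=> hs a; apply: refers_cat. Qed.

Lemma keeps_input_init : keeps_input (st_computed (init C)).
Proof.
case=> [j|j] lab u; first by [].
rewrite /= size_map size_enum_ord ltn_ord (nth_map j) ?size_enum_ord //.
by rewrite nth_ord_enum.
Qed.

(** Induction on [phi] for arbitrary [s], because the second operand of a connective is evaluated
    after the measures of the first. *)
Lemma condition_steps_creates (phi : condition D k l) s :
  keeps_input s -> creates s (condition_steps (size s) phi) (truth phi).
Proof.
have last0 r (v : measure C) : refers (r ++ [:: v]) (Computed k (size r)) v.
  by have := refers_last r [::] v; rewrite addn0.
have szS (r t : seq (measure C)) (v : measure C) n : n = (size t).+1 ->
    (size r + n)%N = size (r ++ rcons t v).
  by move=> ->; rewrite size_cat size_rcons.
(* The truth value of a subcondition is the last of its [n] measures; [n] is a successor, so the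
   predecessor is not truncated. *)
have lastS (r t : seq (measure C)) (v : measure C) n : n = (size t).+1 ->
    refers (r ++ rcons t v) (Computed k (size r + n).-1) v.
  by move=> ->; rewrite addnS; apply: refers_last.
elim: phi s => [i L b|i L o b|i L o b|a q|a q|a q|p IHp|p IHp q IHq
               |p IHp q IHq] s hs /=.
- by apply: creates1 => // lab u; congr Some; apply/ffunP => x; rewrite !ffunE.
- by apply: creates1 => // lab u; congr Some; apply/ffunP => x; rewrite !ffunE.
- by apply: creates1 => // lab u; congr Some; apply/ffunP => x; rewrite !ffunE.
(* A single step leaves no intermediate measure: [t] is empty and the constant sits at position
   [size s]. *)
- apply: creates_cat (creates_const s q) _ => -[] // _.
  apply: creates1 => // lab u.
  rewrite /= (lift2_refers _ _ _ (refers_cat _ (hs a)) (last0 _ _)).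
  by congr Some; apply/ffunP => x; rewrite !ffunE /= (inj_eq (fmorph_inj _)).
- apply: creates_cat (creates_const s q) _ => -[] // _.
  apply: creates1 => // lab u.
  rewrite /= (lift2_refers _ _ _ (refers_cat _ (hs a)) (last0 _ _)).
  by congr Some; apply/ffunP => x; rewrite !ffunE /= ltr_rat.
- apply: creates_cat (creates_const s q) _ => -[] // _.
  apply: creates1 => // lab u.
  rewrite /= (lift2_refers _ _ _ (last0 _ _) (refers_cat _ (hs a))).
  by congr Some; apply/ffunP => x; rewrite !ffunE /= ltr_rat.
- apply: creates_cat (IHp s hs) _ => t szt.
  apply: creates_cat (creates_const _ 0) _ => -[] // _.
  apply: creates1 => // lab u; have vp := lastS s t (truth p) _ szt.
  rewrite (szS s t (truth p) _ szt) in vp *.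
  rewrite /= (lift2_refers _ _ _ (refers_cat _ vp) (last0 _ _)).
  congr Some; apply/ffunP => x; rewrite !ffunE rmorph0 /=.
  by case: satisfies; rewrite ?oner_eq0 ?eqxx.
- apply: creates_cat (IHp s hs) _ => t szt.
  have vp := lastS s t (truth p) _ szt.
  rewrite (szS s t (truth p) _ szt) in vp *.
  apply: creates_cat (IHq _ (keeps_input_cat _ hs)) _ => t' szt'.
  apply: creates1 => // lab u.
  rewrite /= (lift2_refers _ _ _ (refers_cat _ vp) (lastS _ _ _ _ szt')).
  by congr Some; apply/ffunP => x; rewrite !ffunE /= -natrM mulnb.
- apply: creates_cat (IHp s hs) _ => t szt.
  have vp := lastS s t (truth p) _ szt.
  rewrite (szS s t (truth p) _ szt) in vp *.
  (* From here on only the position of the truth value of [p] and the invariant matter, so the list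
     is abstracted to [r]. *)
  move: (s ++ _) vp (keeps_input_cat (rcons t (truth p)) hs) => {szt}r vp hr.
  apply: creates_cat (IHq _ hr) _ => t' szt'.
  have vq := lastS r t' (truth q) _ szt'.
  rewrite (szS r t' (truth q) _ szt') in vq *.
  have /= := refers_cat (rcons t' (truth q)) vp.
  move: (r ++ rcons t' _) vq => {szt'}r' vq {}vp.
  (* The sum may be 2, so it is not yet a truth value; comparing it with the constant 0 placed right
     after it makes it Boolean. *)
  apply: (creates_cat (ts := [:: _]) (v := truth p + truth q)).
    apply: creates1 => // lab u; rewrite /= (lift2_refers _ _ _ vp vq).
    by congr Some; apply/ffunP => x; rewrite !ffunE.
  move=> [] // _; apply: creates_cat (creates_const _ 0) _ => -[] // _.
  apply: creates1 => // lab u.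
  have v0 := last0 (r' ++ [:: truth p + truth q]) [ffun=> ratr 0].
  rewrite size_cat addn1 in v0.
  rewrite /= (lift2_refers _ _ _ v0 (refers_cat _ (last0 _ _))).
  congr Some; apply/ffunP => x; rewrite !ffunE rmorph0 /=.
  by do 2!case: satisfies; rewrite ?addr0 ?add0r ?ltr01 ?ltxx ?addr_gt0 ?ltr01.
Qed.

(* [z] is a computed measure with value 0. *)
Definition copy_steps (z : nat) : seq (transformation D k) :=
  [seq TAdd D (Computed k (val j)) (Computed k z) | j <- enum 'I_l].

(** Each copy is appended, which preserves both the input references and the reference to the zero
    measure. *)
Lemma run_copy_steps s z lab u : keeps_input s ->
  refers s (Computed k z) 0 ->
  run (State s lab u) (copy_steps z) =
    Some (State (s ++ [seq input_measure (inr j) | j <- enum 'I_l]) lab u).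
Proof.
rewrite /copy_steps; elim: (enum _) s => [|j js IH] s hs z0 /=.
  by rewrite cats0.
rewrite (lift2_refers _ _ _ (hs (inr j)) z0) /= /register -cats1 IH.
- rewrite -catA /=; congr (Some (State (_ ++ _ :: _) _ _)).
  by apply/ffunP => x; rewrite !ffunE addr0.
- exact: keeps_input_cat.
- exact: refers_cat.
Qed.

End Condition.

(** * The dice operation and its correctness *)

Definition dice_operation (d : nat) (D : 'I_d -> dimension) (k l : nat)
    (phi : condition D k l) : operation D k :=
  let ts := condition_steps l phi in
  let n := (l + size ts)%N in
  let v := Existing D (Computed k n.-1) in
  Operation (ts ++ [:: TConst D k 0] ++ copy_steps D k l n) (Some v) v.

Lemma content_ext (k l : nat) (c c' : content k l) :
  protected c = protected c' -> computed c = computed c' -> flag c = flag c' ->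
  c = c'.
Proof. by case: c c' => [? ? ?] [? ? ?] /= -> -> ->. Qed.

(** The Boolean check succeeds because [truth] takes only the values 0 and 1. *)
Lemma create_existing (d : nat) (D : 'I_d -> dimension) (k l : nat)
    (C : cube D k l) (s : seq (measure C)) lab u r phi :
  refers s r (truth C phi) ->
  create (State s lab u) (Existing D r) =
    Some (truth C phi, State (rcons s (truth C phi)) lab u).
Proof.
move=> sr; rewrite /create sr; case: ifP => // /forallP[] x.
by rewrite ffunE; case: satisfies; rewrite eqxx ?orbT.
Qed.

Theorem mainTheorem2 (d : nat) (hd : (0 < d)%N) (D : 'I_d -> dimension)
  (k l : nat) (phi : condition D k l) :
  expressible (dice phi).
Proof.
exists (dice_operation phi) => C C'.
pose s0 := st_computed (init C).
have sz0 : size s0 = l by rewrite size_map size_enum_ord.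
have [t szt rt] := condition_steps_creates phi (keeps_input_init C).
rewrite -/s0 sz0 in szt rt.
pose w := truth C phi; pose n := (l + size (condition_steps l phi))%N.
pose s1 := s0 ++ rcons t w.
have sz1 : size s1 = n by rewrite size_cat size_rcons sz0 -szt.
have w1 : refers s1 (Computed k n.-1) w.
  by have := refers_last s0 t w; rewrite sz0 /n szt addnS.
(* The truth value of [phi] is at position [n.-1]; the zero used for copying follows at position
   [n]. *)
pose s2 := s1 ++ [:: 0].
have z2 : refers s2 (Computed k n) 0.
  by have := refers_last s1 [::] 0; rewrite addn0 sz1.
have w2 : refers s2 (Computed k n.-1) w by apply: refers_cat.
have k2 : keeps_input s2 by do 2!apply: keeps_input_cat; apply: keeps_input_init.
pose cs := [seq input_measure C (inr j) | j <- enum 'I_l].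
have szc : size cs = l by rewrite size_map size_enum_ord.
have runE : run (init C) (op_steps (dice_operation phi)) =
    Some (State (s2 ++ cs) [::] 0%N).
  rewrite run_cat -[init C]/(State s0 [::] 0%N) rt /= /register /= -cats1.
  have -> : [ffun=> ratr 0] = 0 :> measure C.
    by apply/ffunP => x; rewrite !ffunE rmorph0.
  exact: run_copy_steps.
have w3 : refers (s2 ++ cs) (Computed k n.-1) w by apply: refers_cat.
have w4 : refers (rcons (s2 ++ cs) w) (Computed k n.-1) w.
  by rewrite -cats1; apply: refers_cat.
have deltaE : create_destructor (State (s2 ++ cs) [::] 0%N)
    (op_destructor (dice_operation phi)) =
    Some (w, State (rcons (s2 ++ cs) w) [::] 0%N) := create_existing _ _ w3.
have flagE : create (State (rcons (s2 ++ cs) w) [::] 0%N)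
    (op_flag (dice_operation phi)) =
    Some (w, State (rcons (rcons (s2 ++ cs) w) w) [::] 0%N) :=
  create_existing _ _ w4.
(* The output measures are read off before the destructor and the flag are appended, so the last [l]
   of them are exactly the copies [cs]. *)
have nthE (j : 'I_l) :
    nth 0 (s2 ++ cs) (size (s2 ++ cs) - l + j)%N = input_measure C (inr j).
  rewrite size_cat szc addnK nth_cat ltnNge leq_addr /= addKn.
  by rewrite (nth_map j) ?size_enum_ord // nth_ord_enum.
have contentE (x : full_cell C) : C (val x) = Some (content_at x).
  exact: svalP (full_content x).
(* Running is deterministic, so any witnesses of an output must be the states computed above;
   conversely these states serve as witnesses for the dice. *)
split=> [[st [delta [st' [v [st'' []]]]]]|->].
  rewrite runE => -[<-]; rewrite deltaE => -[<- <-].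
  rewrite flagE => -[<- _] _ [C'0 C'E].
  apply/ffunP => x; rewrite ffunE; case Cx: (C x) => [c|]; last exact: C'0.
  have fx : C x by rewrite Cx.
  pose y : full_cell C := exist _ x fx.
  have cE : c = content_at y by apply: Some_inj; rewrite -contentE -Cx.
  have := C'E y; rewrite ffunE /= -cE; case: satisfies; last by rewrite eqxx.
  rewrite oner_eq0 eqxx => -[c' -> [pE mE fE]]; congr Some.
  apply: content_ext => //=; apply/ffunP => j.
  (* The output fixes computed measures only through [ratr], whose injectivity recovers the rational
     values. *)
  by have := mE j; rewrite nthE ffunE -cE => /fmorph_inj.
exists (State (s2 ++ cs) [::] 0%N), w, (State (rcons (s2 ++ cs) w) [::] 0%N), w.
exists (State (rcons (rcons (s2 ++ cs) w) w) [::] 0%N).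
split=> //; first by rewrite size_cat szc leq_addl.
split=> [x Cx|x]; first by rewrite ffunE Cx.
rewrite !ffunE contentE; case: satisfies; last by rewrite eqxx.
rewrite oner_eq0; eexists; first by [].
by split=> //= [j|]; rewrite ?eqxx // nthE ffunE.
Qed.
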